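(* Let $F$ be a field of characteristic $2$, let $p$ and $q$ be anisotropic quasilinear quadratic forms of dimension $\geq 2$ over $F$, and let $\epsilon$ be the unique integer in $[1, 2^{\mathfrak{d}_1(p)}]$ such that $\mathfrak{i}_0(q_{F(p)}) + \epsilon \equiv 0 \pmod{2^{\mathfrak{d}_1(p)}}$. Then either (1) $\mathfrak{i}_0(q_{F(p)}) \leq \frac{\dim(q) - \epsilon}{2}$, or (2) $\mathfrak{i}_0(q_{F(p)})$ is divisible by $2^{\mathrm{lndeg}(p)-1}$.
   Context: Quasilinear form (char $2$): an additive quadratic form, equivalently $\langle a_1,\dots,a_n\rangle:(\lambda_i)\mapsto\sum a_i\lambda_i^2$; $\langle a_i\rangle\otimes\langle b_j\rangle\simeq\langle a_ib_j\rangle$. $D(\phi)$ is the set of values represented by $\phi$. $\mathfrak{i}_0(\phi)$ is the maximal dimension of a totally isotropic subspace; $\phi_{\mathrm{an}}$ is the induced form on $V_\phi/U$, $U$ the subspace of isotropic vectors. $F(p)$ is the function field of the projective quadric $\{p=0\}$; $p_1:=(p_{F(p)})_{\mathrm{an}}$. An $s$-fold quasi-Pfister form is $\langle 1,a_1\rangle\otimes\cdots\otimes\langle1,a_s\rangle$ ($a_i\neq0$). $\phi$ is divisible by $\pi$ if $\phi\simeq\pi\otimes r$ for some form $r$. $\mathfrak{d}_0(\phi)$ is the largest $s\ge0$ such that $\phi_{\mathrm{an}}$ is divisible by an $s$-fold quasi-Pfister form; $\mathfrak{d}_1(p):=\mathfrak{d}_0(p_1)$. The norm field $N(p)$ is the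 smallest subfield of $F$ containing all ratios of nonzero elements of $D(p)$, and $\mathrm{lndeg}(p):=\log_2[N(p):F^2]$. *)

(* Defs.v *)
From HB Require Import structures.
From mathcomp Require Import all_boot all_order all_algebra.
From mathcomp Require Import boolp classical_sets.
From mathcomp Require Import mpoly.

Set Implicit Arguments.
Unset Strict Implicit.
Unset Printing Implicit Defensive.

Import GRing.Theory.

Local Open Scope classical_set_scope.
Local Open Scope ring_scope.

(** A quasilinear quadratic form over a field [F] of characteristic 2 is given
    by its coefficients: [:: a_1; ...; a_n] : seq F stands for the diagonal
    form <a_1, ..., a_n> on F^n.  Zero coefficients are allowed, the dimension
    is [size a], and extension of scalars along [iota] is [map iota a]. *)

Section Forms.
Variable F : fieldType.
Implicit Types a b r pi : seq F.

Definition qval a (v : 'rV[F]_(size a)) : F :=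
  \sum_(i < size a) a`_i * v 0 i ^+ 2.

Definition anisotropic a : Prop := forall v, qval (a := a) v = 0 -> v = 0.

(** The set D(a). *)
Definition values a : set F := range (@qval a).

Definition isometric a b : Prop :=
  exists f : {linear 'rV[F]_(size a) -> 'rV[F]_(size b)},
    bijective f /\ forall v, qval (f v) = qval v.

Definition totally_isotropic a (U : {vspace 'rV[F]_(size a)}) : Prop :=
  forall v, v \in U -> qval v = 0.

Definition i0 a : nat :=
  \max_(k < (size a).+1 |
        `[< exists2 U, totally_isotropic (a := a) U & \dim U = k >]) k.

(** [b] is the form induced by [a] on the quotient of F^(size a) by the
    subspace of isotropic vectors; [f] is the quotient map. *)
Definition is_anisotropic_part a b : Prop :=
  exists f : {linear 'rV[F]_(size a) -> 'rV[F]_(size b)},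
    [/\ forall w, exists v, f v = w,
        forall v, f v = 0 <-> qval v = 0
      & forall v, qval (f v) = qval v].

(** The anisotropic part, well defined up to isometry only; see [anpartP]. *)
Definition anpart a : seq F := xget [::] (is_anisotropic_part a).

Definition tensor a b : seq F := [seq x * y | x <- a, y <- b].

(** <1, c_1> (x) ... (x) <1, c_s>, and <1> if s = 0. *)
Definition quasi_pfister (c : seq F) : seq F :=
  foldr (fun x => tensor [:: 1; x]) [:: 1] c.

Definition is_quasi_pfister (s : nat) pi : Prop :=
  exists c : s.-tuple F, all (fun x => x != 0) c /\ isometric pi (quasi_pfister c).

Definition divisible a pi : Prop := exists r, isometric a (tensor pi r).

(** If [anpart a] is nonzero and divisible by an [s]-fold quasi-Pfister form,
    then 2 ^ s <= size (anpart a), so the bound on [s] is harmless.  If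
    [anpart a] is the zero-dimensional form there is no largest [s], and the
    value [size a] is junk. *)
Definition d0 a : nat :=
  \max_(s < (size a).+1 |
        `[< exists2 pi, is_quasi_pfister s pi & divisible (anpart a) pi >]) s.

Definition is_subfield (S : set F) : Prop := GRing.divring_closed (mem S).

Definition norm_field a : set F :=
  smallest is_subfield
    [set z | exists x y, [/\ values a x, values a y, x != 0, y != 0 & z = x / y]].

Definition squares : set F := range (fun x : F => x ^+ 2).

(** [N : E] = m, for subfields E of N. *)
Definition has_degree (E N : set F) (m : nat) : Prop :=
  exists e : 'I_m -> F, (forall i, N (e i)) /\
    forall x, N x ->
      exists! c : {ffun 'I_m -> F}, (forall i, E (c i)) /\ x = \sum_i c i * e i.

(** The degree is finite for [norm_field a] over [squares], and a power of 2,
    so that the truncated logarithm is exact. *)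
Definition lndeg a : nat :=
  trunc_log 2 (xget 0%N (has_degree squares (norm_field a))).

Definition form_poly a : {mpoly F[size a]} :=
  \sum_(i < size a) a`_i *: 'X_i ^+ 2.

(** [K], with [iota : F -> K], is the function field of the projective quadric
    {a = 0}: for the homogeneous coordinates [x] of the generic point, the
    homogeneous polynomials vanishing at [x] are those in the ideal (a), and
    the elements of [K] are the fractions f(x) / g(x) with f, g homogeneous of
    the same degree and g outside (a).  This presupposes that the quadric is
    integral, as it is when [a] is anisotropic of dimension at least 2. *)
Definition is_function_field a (K : fieldType) (iota : {rmorphism F -> K}) : Prop :=
  exists x : 'I_(size a) -> K,
    (forall d (f : {mpoly F[size a]}), f \is d.-homog ->
       ((map_mpoly iota f).@[x] = 0 <-> exists g, f = g * form_poly a)) /\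
    (forall y : K, exists d (f g : {mpoly F[size a]}),
       [/\ f \is d.-homog, g \is d.-homog, (map_mpoly iota g).@[x] != 0
         & y = (map_mpoly iota f).@[x] / (map_mpoly iota g).@[x]]).

End Forms.

(** d_1(p) = d_0(p_1), where p_1 is the anisotropic part of p over K = F(p). *)
Definition d1 (F K : fieldType) (iota : {rmorphism F -> K}) (p : seq F) : nat :=
  d0 (anpart (map iota p)).

Section AnisotropicPart.
Variables (F : fieldType) (char2 : 2%N \in [pchar F]) (a : seq F).

Lemma qvalD (u v : 'rV[F]_(size a)) : qval (u + v) = qval u + qval v.
Proof.
rewrite /qval -big_split; apply: eq_bigr => i _ /=.
by rewrite mxE -mulrDr sqrrD mulr2n (addrr_pchar2 char2) addr0.
Qed.

Lemma qvalZ c (v : 'rV[F]_(size a)) : qval (c *: v) = c ^+ 2 * qval v.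
Proof.
by rewrite /qval mulr_sumr; apply: eq_bigr => i _; rewrite mxE exprMn mulrCA.
Qed.

Lemma isotropic_space :
  exists U : {vspace 'rV[F]_(size a)}, forall v, (v \in U) = (qval v == 0).
Proof.
pose P k := `[< exists2 U, totally_isotropic (a := a) U & \dim U = k >].
have q0 : qval (0 : 'rV[F]_(size a)) = 0.
  by rewrite -(scale0r 0) qvalZ expr0n mul0r.
have exP : exists k, P k.
  exists 0%N; apply/asboolP; exists 0%VS; last by rewrite dimv0.
  by move=> v; rewrite memv0 => /eqP ->.
have leP (k : nat) : P k -> (k <= \dim {:'rV[F]_(size a)})%N.
  by move=> /asboolP[U _ <-]; apply: dimvS; exact: subvf.
case: (ex_maxnP exP leP) => k /asboolP[U Uiso dimU] kmax.
exists U => v; apply/idP/eqP => [/Uiso //|qv0].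
have : (\dim (U + <[v]>)%VS <= \dim U)%N.
  rewrite dimU; apply/kmax/asboolP; exists (U + <[v]>)%VS => //.
  move=> _ /memv_addP[u uU [_ /vlineP[c ->] ->]].
  by rewrite qvalD qvalZ qv0 (Uiso u uU) mulr0 addr0.
move=> le; have /eqP -> : U == (U + <[v]>)%VS by rewrite eqEdim addvSl le.
by have := memv_add (mem0v U) (memv_line v); rewrite add0r.
Qed.

Lemma anpartP : is_anisotropic_part a (anpart a).
Proof.
apply: xgetPex.
have [U UP] := isotropic_space.
pose C := (U^C)%VS; pose X := vbasis C.
pose b := [seq qval v | v <- X].
have sb : size b = \dim C by rewrite size_map size_tuple.
pose pr := daddv_pi C U.
have CU0 : (C :&: U)%VS = 0%VS by rewrite capvC capv_compl.
have CUT : (C + U)%VS = fullv by rewrite addvC addv_complf.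
have vE v : v = pr v + daddv_pi U C v by rewrite daddv_pi_add ?CUT ?memvf .
have qpr v : qval v = qval (pr v).
  rewrite {1}[v]vE qvalD; have := memv_pi U C v.
  by rewrite UP => /eqP ->; rewrite addr0.
pose f v : 'rV[F]_(size b) := \row_i coord X (cast_ord sb i) (pr v).
have f_lin : linear f.
  by move=> c u v; apply/rowP => i; rewrite !mxE !linearP.
pose fL : {linear 'rV[F]_(size a) -> 'rV[F]_(size b)} :=
  HB.pack f (GRing.isLinear.Build _ _ _ _ f f_lin).
have qsum n (h : 'I_n -> 'rV[F]_(size a)) : qval (\sum_i h i) = \sum_i qval (h i).
  apply: (big_morph (@qval _ a)) => [u v|]; first exact: qvalD.
  by rewrite -(scale0r 0) qvalZ expr0n mul0r.
have qf v : qval (f v) = qval v.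
  rewrite [RHS]qpr (coord_vbasis (memv_pi C U v)) -/X qsum /qval.
  rewrite (reindex (cast_ord (esym sb))) /=; last first.
    by apply: onW_bij; exists (cast_ord sb) => i; rewrite ?cast_ordK ?cast_ordKV.
  apply: eq_bigr => i _; rewrite mxE cast_ordKV.
  rewrite -[RHS]/(qval (coord X i (pr v) *: X`_i)) qvalZ mulrC.
  by rewrite (nth_map 0) ?size_tuple.
exists b, fL; split => /= [w|v|v]; last exact: qf.
  pose v := \sum_(i < \dim C) w 0 (cast_ord (esym sb) i) *: X`_i.
  have vC : v \in C.
    by apply: memv_suml => i _; rewrite memvZ // vbasis_mem // mem_nth ?size_tuple.
  exists v; apply/rowP => i; rewrite !mxE /pr daddv_pi_id //.
  by rewrite coord_sum_free ?cast_ordK // (basis_free (vbasisP C)).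
split => [fv0|/eqP]; first by rewrite -qf fv0 /qval big1 // => i _; rewrite mxE expr0n mulr0.
rewrite -UP => vU; suff pr0 : pr v = 0 by apply/rowP => i; rewrite !mxE pr0 linear0.
apply/eqP; rewrite -memv0 -CU0 memv_cap memv_pi /=.
have -> : pr v = v - daddv_pi U C v by rewrite {2}[v]vE addrK.
by rewrite memvB // memv_pi.
Qed.

End AnisotropicPart.

(* Main.v *)
Require Import Defs.
From HB Require Import structures.
From mathcomp Require Import all_boot all_order all_algebra.
From mathcomp Require Import boolp classical_sets mpoly.
From mathcomp Require Import zify ring lra.

(** Write K = F(p), and let V, P be the K^2-spans in K of the values of q and
    of p.  Dimensions over K^2 are counted as sizes of anisotropic forms with a
    given set of values; thus i0(q_K) = dim q - dim V.

    The key point is that U = {w | w P <= V} has dimension at least i0(q_K).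
    An isotropic vector of q_K is (f_j(x))_j for homogeneous polynomials f_j
    with sum_j q_j f_j^2 = p g.  Evaluating at x + t e_i and comparing the
    coefficients of t^2 gives sum_j q_j (d_i f_j)(x)^2 = p_i g(x), because
    p(x + t e_i) = p_i t^2.  So g(x) is in U, and eliminating one variable
    modulo p shows that g(x) = 0 only for the zero vector.

    Let T be the span of U P, a subspace of V.  It is stable under the field of
    values of the quasi-Pfister form dividing p_1, so 2^d1 divides dim T, and
    dim T >= dim U >= i0(q_K).  If dim T > i0(q_K), then the least multiple of
    2^d1 above i0(q_K), namely i0(q_K) + eps, is at most dim T <= dim V, which
    is (1).  Otherwise T = p_0 U, so T is stable under K^2 N(p).  The latter
    has degree a power of 2 over K^2, and this degree is at least
    2^(lndeg p - 1) because i0 <= dim / 2 for the form of values N(p). *)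

Set Implicit Arguments.
Unset Strict Implicit.
Unset Printing Implicit Defensive.

Import Order.TTheory GRing.Theory Num.Theory.
Local Open Scope ring_scope.

(** * Value sets and dimension over the subfield of squares *)

Section Values.
Variables (F : fieldType) (char2 : 2%N \in [pchar F]).
Implicit Types (a b r : seq F) (x y z : F) (S : set F).

Definition diag_sum a (c : nat -> F) : F := \sum_(i < size a) a`_i * c i ^+ 2.

Lemma valuesP a z : values a z <-> exists c, z = diag_sum a c.
Proof.
split=> [[v _ <-]|[c ->]].
  exists (fun i => if insub i is Some j then v 0 j else 0).
  by apply: eq_bigr => i _; rewrite valK.
by exists (\row_i c i) => //; apply: eq_bigr => i _; rewrite mxE.
Qed.

Lemma anisotropicP a : anisotropic a <->
  forall c, diag_sum a c = 0 -> forall i, (i < size a)%N -> c i = 0.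
Proof.
split=> [an c c0 i lti|an v v0].
  have /an/rowP/(_ (Ordinal lti)) : qval (a := a) (\row_i c i) = 0.
    by rewrite -[RHS]c0; apply: eq_bigr => j _; rewrite mxE.
  by rewrite !mxE.
apply/rowP => i; rewrite mxE.
pose c i := if insub i is Some j then v 0 j else 0.
have /an/(_ i (ltn_ord i)) : diag_sum a c = 0.
  by rewrite -[RHS]v0; apply: eq_bigr => j _; rewrite /c valK.
by rewrite /c valK.
Qed.

Lemma sum_sqr (R : comNzRingType) (I : Type) (s : seq I) (f : I -> R) :
  2%N \in [pchar R] -> (\sum_(i <- s) f i) ^+ 2 = \sum_(i <- s) f i ^+ 2.
Proof.
move=> R2; apply: (big_morph (fun x : R => x ^+ 2)); last by rewrite expr0n.
by move=> u v; rewrite sqrrD mulr2n (addrr_pchar2 R2) addr0.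
Qed.

Lemma diag_sum_cat a b c :
  diag_sum (a ++ b) c = diag_sum a c + diag_sum b (fun i => c (size a + i)%N).
Proof.
rewrite /diag_sum size_cat big_split_ord; congr (_ + _); apply: eq_bigr => i _.
  by rewrite nth_cat /= ltn_ord.
by rewrite nth_cat /= ltnNge leq_addr addKn.
Qed.

Definition sqr_module S : Prop :=
  [/\ S 0, forall x y, S x -> S y -> S (x + y) & forall c x, S x -> S (c ^+ 2 * x)].

Lemma values_module a : sqr_module (values a).
Proof.
split=> [|x y /valuesP[c ->] /valuesP[d ->]|e x /valuesP[c ->]]; apply/valuesP.
- by exists (fun=> 0); rewrite /diag_sum big1 // => i _; rewrite expr0n mulr0.
- exists (fun i => c i + d i); rewrite -big_split; apply: eq_bigr => i _ /=.
  by rewrite -mulrDr sqrrD mulr2n (addrr_pchar2 char2) addr0.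
- by exists (fun i => e * c i); rewrite mulr_sumr; apply: eq_bigr => i _; ring.
Qed.

Lemma mem_values a x : x \in a -> values a x.
Proof.
move=> /(nthP 0)[i lti <-]; apply/valuesP; exists (fun j => (j == i)%:R).
rewrite /diag_sum (bigD1 (Ordinal lti)) //= eqxx big1 ?addr0; first by rewrite expr1n mulr1.
by move=> j /negPf nej; rewrite -val_eqE /= in nej; rewrite nej expr0n mulr0.
Qed.

Lemma values_min a S : sqr_module S -> (forall x, x \in a -> S x) ->
  (values a `<=` S)%classic.
Proof.
move=> [S0 SD SZ] aS _ /valuesP[c ->]; apply: (big_ind S) => // i _.
by rewrite mulrC; apply/SZ/aS/mem_nth.
Qed.

Lemma sqr_moduleZ S y : sqr_module S -> sqr_module [set x | S (y * x)].
Proof.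
move=> [S0 SD SZ]; split=> [|u v|c u] /=; first by rewrite mulr0.
  by rewrite mulrDr; apply: SD.
by rewrite mulrCA; apply: SZ.
Qed.

Lemma qval0 a : qval (0 : 'rV_(size a)) = 0.
Proof. by rewrite -(scale0r 0) qvalZ expr0n mul0r. Qed.

Lemma transfer_mx a b : (values a `<=` values b)%classic ->
  exists M : 'M_(size a, size b), forall v, qval (v *m M) = qval v.
Proof.
move=> ab.
have /choice[f fE] (i : 'I_(size a)) : exists v : 'rV_(size b), qval v = a`_i.
  by have [v _ vE] := ab _ (mem_values (mem_nth 0 (ltn_ord i))); exists v.
exists (\matrix_i f i) => v; rewrite mulmx_sum_row.
rewrite (big_morph (@qval _ b) (qvalD char2 (a := b)) (qval0 b)).
by apply: eq_bigr => i _; rewrite qvalZ rowK fE mulrC.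
Qed.

Lemma anisotropic_row_free a b (M : 'M_(size a, size b)) : anisotropic a ->
  (forall v, qval (v *m M) = qval v) -> row_free M.
Proof.
move=> an ME; rewrite -kermx_eq0; apply/eqP/row_matrixP => i.
rewrite row0; apply: an; rewrite -ME -row_mul mulmx_ker row0; exact: qval0.
Qed.

Lemma anisotropic_leq a b : anisotropic a -> (values a `<=` values b)%classic ->
  (size a <= size b)%N.
Proof.
move=> an /transfer_mx[M /(anisotropic_row_free an)/eqP <-]; exact: rank_leq_col.
Qed.

Lemma transfer_surj a b : anisotropic a -> (values a `<=` values b)%classic ->
  (size b <= size a)%N -> forall w : 'rV_(size b), exists2 v : 'rV_(size a),
    qval v = qval w & (qval v = 0 -> w = 0).
Proof.
move=> an ab ba w; have [M ME] := transfer_mx ab.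
have Mfree := anisotropic_row_free an ME.
have Mfull : row_full M.
  by rewrite /row_full eqn_leq rank_leq_col (eqP Mfree).
have /submxP[v wE] : (w <= M)%MS by rewrite submx_full.
by exists v; rewrite wE ?ME // => /an ->; rewrite mul0mx.
Qed.

Lemma anisotropic_eq_values a b : anisotropic a -> (values a `<=` values b)%classic ->
  (size b <= size a)%N -> (values b `<=` values a)%classic.
Proof.
move=> an ab ba _ [w _ <-]; have [v vE _] := transfer_surj an ab ba w.
by exists v.
Qed.

Lemma anisotropic_size a b : anisotropic a -> (values a `<=` values b)%classic ->
  (size b <= size a)%N -> anisotropic b.
Proof.
by move=> an ab ba w w0; have [v vE v0] := transfer_surj an ab ba w; apply: v0; rewrite vE.
Qed.

Lemma i0_isotropic_space a (U : {vspace 'rV[F]_(size a)}) :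
  (forall v, (v \in U) = (qval v == 0)) -> i0 a = \dim U.
Proof.
move=> UE; apply/eqP; rewrite eqn_leq; apply/andP; split.
  apply/bigmax_leqP => k /asboolP[W Wiso <-]; apply/dimvS/subvP => v /Wiso v0.
  by rewrite UE v0.
have ltU : (\dim U < (size a).+1)%N.
  by rewrite ltnS (leq_trans (dimvS (subvf U))) // dimvf /dim /= mul1n.
apply: (@leq_bigmax_cond _ _ (fun k : 'I_(size a).+1 => nat_of_ord k) (Ordinal ltU)).
by apply/asboolP; exists U => // v; rewrite UE => /eqP.
Qed.

Lemma i0_anisotropic_basis a b : anisotropic b -> values a = values b ->
  (i0 a + size b)%N = size a.
Proof.
move=> an ab; have [M ME] : exists M : 'M_(size a, size b),
    forall v, qval (v *m M) = qval v by apply: transfer_mx; rewrite ab.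
pose f : 'Hom('rV_(size a), 'rV_(size b)) := linfun (mulmxr M).
have fE v : qval (f v) = qval v by rewrite lfunE /= ME.
rewrite (@i0_isotropic_space a (lker f)) => [|v]; last first.
  rewrite memv_ker -fE; apply/eqP/eqP => [->|/an //]; exact: qval0.
have limgf : limg f = fullv.
  apply/vspaceP => w; rewrite memvf; have : values b (qval w) by exists w.
  rewrite -ab => -[v _ vE]; have -> : w = f v.
    apply/eqP; rewrite -subr_eq0; apply/eqP/an; rewrite qvalD // -scaleN1r qvalZ fE vE.
    by rewrite sqrrN expr1n mul1r addrr_pchar2.
  exact: memv_img (memvf v).
have := limg_ker_dim f fullv; rewrite limgf capfv !dimvf /dim /= !mul1n.
by [].
Qed.

Lemma mem_tensor a b z : reflect (exists x y, [/\ x \in a, y \in b & z = x * y])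
  (z \in tensor a b).
Proof.
apply: (iffP allpairsP) => [[[x y] [/= xa yb ->]]|[x [y [xa yb ->]]]].
  by exists x, y.
by exists (x, y).
Qed.

Lemma size_tensor a b : size (tensor a b) = (size a * size b)%N.
Proof. exact: size_allpairs. Qed.

Lemma values_mul_min a b S : sqr_module S ->
  (forall x y, x \in a -> y \in b -> S (x * y)) ->
  forall x y, values a x -> values b y -> S (x * y).
Proof.
move=> SM abS x y xa yb.
have := values_min (sqr_moduleZ x SM) (a := b); apply=> // {yb}y yb /=.
rewrite mulrC; have := values_min (sqr_moduleZ y SM) (a := a); apply=> // {xa}x xa /=.
by rewrite mulrC; apply: abS.
Qed.

Lemma values_tensor a b x y : values a x -> values b y -> values (tensor a b) (x * y).
Proof.
apply: values_mul_min => [|{}x {}y xa yb]; first exact: values_module.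
by apply/mem_values/mem_tensor; exists x, y.
Qed.

Lemma values_tensor_min a b S : sqr_module S ->
  (forall x y, values a x -> values b y -> S (x * y)) ->
  (values (tensor a b) `<=` S)%classic.
Proof.
move=> SM abS; apply: values_min => // _ /mem_tensor[x [y [xa yb ->]]].
by apply: abS; apply: mem_values.
Qed.

Lemma values_tensorS a a' b b' : (values a `<=` values a')%classic ->
  (values b `<=` values b')%classic ->
  (values (tensor a b) `<=` values (tensor a' b'))%classic.
Proof.
move=> aa bb; apply: values_tensor_min => [|x y /aa xa /bb yb].
  exact: values_module.
exact: values_tensor.
Qed.

Lemma anisotropic_cat a b : anisotropic a -> anisotropic b ->
  (forall x, values a x -> values b x -> x = 0) -> anisotropic (a ++ b).
Proof.
move=> /anisotropicP aa /anisotropicP ab ab0; apply/anisotropicP => c.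
rewrite diag_sum_cat => /eqP; rewrite addr_eq0 (oppr_pchar2 char2) => /eqP E.
have a0 : diag_sum a c = 0.
  by apply: ab0; apply/valuesP; [exists c | rewrite E; eexists].
move=> i; rewrite size_cat => lti; have [ltia|leai] := ltnP i (size a).
  exact: aa a0 i ltia.
have := ab (fun i => c (size a + i)%N).
by rewrite -E a0 => /(_ erefl (i - size a)%N); rewrite subnKC // => -> //; lia.
Qed.

Lemma anisotropic_scale a x : x != 0 -> anisotropic a -> anisotropic (map ( *%R x) a).
Proof.
move=> x0 /anisotropicP an; apply/anisotropicP => c; rewrite size_map => c0.
apply: an; apply: (mulfI x0); rewrite mulr0 -[RHS]c0 mulr_sumr /diag_sum size_map.
by apply: eq_bigr => i _; rewrite (nth_map 0) // mulrA.
Qed.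

Lemma anisotropic_nil : anisotropic ([::] : seq F).
Proof. by apply/anisotropicP. Qed.

Lemma values_scale a x z : values (map ( *%R x) a) z <-> exists2 y, values a y & z = x * y.
Proof.
split.
  apply: (values_min (S := [set z | exists2 y, values a y & z = x * y])); last first.
    by move=> _ /mapP[y ya ->]; exists y => //; apply: mem_values.
  have [v0 vD vZ] := values_module a; split=> [|_ _ [y yv ->] [t tv ->]|c _ [y yv ->]].
  - by exists 0; rewrite ?mulr0.
  - by exists (y + t); [apply: vD | rewrite mulrDr].
  - by exists (c ^+ 2 * y); [apply: vZ | rewrite mulrCA].
move=> [y ya ->]; have := values_min (sqr_moduleZ x (values_module (map ( *%R x) a))).
move=> /(_ a)h; apply: h ya => t ta /=; apply: mem_values; exact: map_f.
Qed.

Lemma sqr_module_inv S x y : sqr_module S -> S (x * y) -> S (x^-1 * y).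
Proof.
move=> [S0 SD SZ] Sxy; have [->|x0] := eqVneq x 0; first by rewrite invr0 mul0r.
have -> : x^-1 * y = x^-1 ^+ 2 * (x * y) by field.
exact: SZ.
Qed.

Section BasisOver.
Variables (c : seq F) (S : set F) (b : seq F).
Hypotheses (c_an : anisotropic c) (c1 : values c 1)
  (cM : forall x y, values c x -> values c y -> values c (x * y))
  (SM : sqr_module S) (cS : forall x y, values c x -> S y -> S (x * y))
  (Sb : (S `<=` values b)%classic).

Lemma basis_over : exists r, anisotropic (tensor c r) /\ values (tensor c r) = S.
Proof.
pose P k := `[< exists r, [/\ size r = k, anisotropic (tensor c r)
                            & forall y, y \in r -> S y] >].
have tS r : (forall y, y \in r -> S y) -> (values (tensor c r) `<=` S)%classic.
  move=> rS; apply: values_min => // _ /mem_tensor[x [y [xc yr ->]]].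
  by apply: cS; [apply: mem_values | apply: rS].
have sc : (0 < size c)%N.
  rewrite lt0n; apply/eqP => /size0nil c0; move: c1; rewrite c0 => /valuesP[d].
  by rewrite /diag_sum big_ord0 => /eqP; rewrite oner_eq0.
have exP : exists k, P k.
  exists 0%N; apply/asboolP; exists [::]; split=> //.
  have -> : tensor c [::] = [::] by apply/nilP; rewrite /nilp size_tensor muln0.
  exact: anisotropic_nil.
have leP k : P k -> (k <= size b)%N.
  move=> /asboolP[r [<- ran rS]].
  have := anisotropic_leq ran (subset_trans (tS _ rS) Sb).
  by rewrite size_tensor; apply: leq_trans; rewrite leq_pmull.
case: (ex_maxnP exP leP) => k /asboolP[r [rk ran rS]] kmax.
exists r; split=> //; apply/seteqP; split; first exact: tS.
move=> s Ss; apply: contrapT => nrs.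
suff : (k.+1 <= k)%N by rewrite ltnn.
apply/kmax/asboolP; exists (s :: r); split; first by rewrite /= rk.
  apply: (@anisotropic_size (map ( *%R s) c ++ tensor c r)).
  - apply: anisotropic_cat => //.
      apply: anisotropic_scale => //; apply/eqP => s0; apply: nrs; rewrite s0.
      by case: (values_module (tensor c r)).
    move=> _ /values_scale[e ce ->]; rewrite mulrC => ves; have [->|e0] := eqVneq e 0.
      by rewrite mul0r.
    case: nrs; rewrite -[s](mulKf e0).
    have: values (tensor c r) (e * (e * s)).
      move: (e * s) ves; apply: values_tensor_min.
        exact/sqr_moduleZ/values_module.
      by move=> x y cx ry /=; rewrite mulrA; apply: values_tensor => //; apply: cM.
    by apply: sqr_module_inv; apply: values_module.
  - apply: values_min => [|x]; first exact: values_module.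
    rewrite mem_cat => /orP[/mapP[y yc ->]|/mem_tensor[y [z [yc zr ->]]]].
      by apply/mem_values/mem_tensor; exists y, s; rewrite mem_head mulrC.
    by apply/mem_values/mem_tensor; exists y, z; rewrite inE zr orbT.
  - by rewrite size_cat size_map !size_tensor mulnS.
by move=> y; rewrite inE => /predU1P[->//|/rS].
Qed.

Lemma dvdn_basis_over a : anisotropic a -> values a = S -> (size c %| size a)%N.
Proof.
move=> an aS; have [r [ran rS]] := basis_over.
suff -> : size a = size (tensor c r) by rewrite size_tensor dvdn_mulr.
by apply/eqP; rewrite eqn_leq !anisotropic_leq // aS rS.
Qed.

End BasisOver.

Lemma tensor1 r : tensor [:: 1] r = r.
Proof. by rewrite /tensor /= cats0 -[RHS]map_id; apply: eq_map => x; rewrite mul1r. Qed.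

Lemma values1 z : values [:: 1] z <-> exists c, z = c ^+ 2.
Proof.
split=> [/valuesP[c ->]|[c ->]].
  by exists (c 0%N); rewrite /diag_sum big_ord1 mul1r.
by apply/valuesP; exists (fun=> c); rewrite /diag_sum big_ord1 mul1r.
Qed.

Lemma anisotropic1 : anisotropic ([:: 1] : seq F).
Proof.
apply/anisotropicP => c; rewrite /diag_sum big_ord1 mul1r => /eqP.
by rewrite sqrf_eq0 => /eqP c0 [|].
Qed.

Lemma anisotropic_basis S b : sqr_module S -> (S `<=` values b)%classic ->
  exists2 a, anisotropic a & values a = S.
Proof.
move=> SM Sb; have E1 : values [:: 1] (1 : F) by apply/values1; exists 1; rewrite expr1n.
have [|x y /values1[c ->]|r] := basis_over anisotropic1 E1 _ SM _ Sb.
- by move=> x y /values1[c ->] /values1[d ->]; apply/values1; exists (c * d); rewrite exprMn.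
- by case: SM => _ _; apply.
by rewrite tensor1 => -[]; exists r.
Qed.

Implicit Types c : seq F.

Lemma quasi_pfister_cons x (c : seq F) z : values (quasi_pfister (x :: c)) z <->
  exists y t, [/\ values (quasi_pfister c) y, values (quasi_pfister c) t & z = y + x * t].
Proof.
rewrite /=; set Q := quasi_pfister c; have [Q0 QD QZ] := values_module Q.
split.
  apply: (values_min (S := [set z | exists y t, [/\ values Q y, values Q t & z = y + x * t]])).
    split=> [|_ _ [y [t [yQ tQ ->]]] [y' [t' [yQ' tQ' ->]]]|e _ [y [t [yQ tQ ->]]]].
    - by exists 0, 0; split; rewrite ?mulr0 ?addr0.
    - by exists (y + y'), (t + t'); split; [apply: QD|apply: QD|ring].
    - by exists (e ^+ 2 * y), (e ^+ 2 * t); split; [apply: QZ|apply: QZ|ring].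
  move=> w /mem_tensor[y [t []]]; rewrite !inE => /pred2P[]-> /mem_values tQ ->.
    by exists t, 0; split; rewrite ?mulr0 ?addr0 ?mul1r.
  by exists 0, t; rewrite add0r.
move=> [y [t [yQ tQ ->]]]; have [_ TD _] := values_module (tensor [:: 1; x] Q).
apply: TD; first rewrite -[y]mul1r; apply: values_tensor => //; apply: mem_values.
  by rewrite !inE eqxx.
by rewrite !inE eqxx orbT.
Qed.

Lemma quasi_pfisterM c x y : values (quasi_pfister c) x ->
  values (quasi_pfister c) y -> values (quasi_pfister c) (x * y).
Proof.
elim: c x y => [|e c IH] x y.
  by move=> /values1[u ->] /values1[v ->]; apply/values1; exists (u * v); rewrite exprMn.
have [Q0 QD QZ] := values_module (quasi_pfister c).
move=> /quasi_pfister_cons[u [v [uQ vQ ->]]] /quasi_pfister_cons[u' [v' [uQ' vQ' ->]]].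
apply/quasi_pfister_cons; exists (u * u' + e ^+ 2 * (v * v')), (u * v' + v * u').
by split; [apply/QD/QZ/IH=> //; exact: IH|apply: QD; exact: IH|ring].
Qed.

Lemma quasi_pfister1 c : values (quasi_pfister c) 1.
Proof.
elim: c => [|e c IH]; first by apply/values1; exists 1; rewrite expr1n.
apply/quasi_pfister_cons; exists 1, 0; split=> //; last by ring.
by case: (values_module (quasi_pfister c)).
Qed.

Lemma size_quasi_pfister c : size (quasi_pfister c) = (2 ^ size c)%N.
Proof. by elim: c => //= e c IH; rewrite size_tensor IH expnS. Qed.

Lemma mem_quasi_pfister c x : x \in c -> values (quasi_pfister c) x.
Proof.
elim: c => // e c IH; rewrite inE => xc; apply/quasi_pfister_cons.
have Q0 : values (quasi_pfister c) 0 by case: (values_module (quasi_pfister c)).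
case/predU1P: xc => [->|/IH Qx]; last by exists x, 0; split=> //; ring.
by exists 0, 1; split=> //; [exact: quasi_pfister1 | ring].
Qed.

Lemma quasi_pfister_min c S : sqr_module S -> S 1 ->
  (forall x y, x \in c -> S y -> S (x * y)) -> (values (quasi_pfister c) `<=` S)%classic.
Proof.
move=> [S0 SD SZ] S1; elim: c => [|e c IH] cS z.
  by move=> /values1[u ->]; rewrite -[_ ^+ 2]mulr1; apply: SZ.
move=> /quasi_pfister_cons[u [v [uQ vQ ->]]].
have cS' x y : x \in c -> S y -> S (x * y) by move=> xc; apply: cS; rewrite inE xc orbT.
by apply: SD; [exact: IH | apply: cS; [rewrite mem_head | exact: IH]].
Qed.

Lemma quasi_pfister_anisotropic c : exists c', anisotropic (quasi_pfister c') /\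
  values (quasi_pfister c') = values (quasi_pfister c).
Proof.
elim: c => [|e c [c' [an E]]]; first by exists [::]; split=> //; exact: anisotropic1.
have QM := values_module (quasi_pfister c); have [Q0 QD QZ] := QM.
have [eQ|neQ] := pselect (values (quasi_pfister c) e).
  exists c'; split=> //; rewrite E; apply/seteqP; split=> z.
    by move=> zQ; apply/quasi_pfister_cons; exists z, 0; split=> //; ring.
  move=> /quasi_pfister_cons[u [v [uQ vQ ->]]]; apply: QD => //; exact: quasi_pfisterM.
have sub : values (quasi_pfister (e :: c')) = values (quasi_pfister (e :: c)).
  apply/seteqP; split=> z /quasi_pfister_cons[u [v [uQ vQ ->]]];
    by apply/quasi_pfister_cons; exists u, v; rewrite ?E // -?E.
exists (e :: c'); split=> //=.
have e0 : e != 0 by apply/eqP => e0; apply: neQ; rewrite e0.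
rewrite /tensor /= cats0; apply: anisotropic_cat.
- by rewrite (eq_map (@mul1r F)) map_id.
- exact: anisotropic_scale.
move=> x; rewrite (eq_map (@mul1r F)) map_id E => xQ /values_scale[y].
rewrite E => yQ xE; have [y0|y0] := eqVneq y 0; first by rewrite xE y0 mulr0.
case: neQ; have -> : e = y^-1 * x by rewrite xE; field.
by apply: sqr_module_inv => //; apply: quasi_pfisterM.
Qed.

End Values.

(** * Isotropic vectors over the function field *)

Lemma mpoly_morph_eq n (R S : comNzRingType) (f g : {rmorphism {mpoly R[n]} -> S}) :
  (forall c, f c%:MP = g c%:MP) -> (forall i, f 'X_i = g 'X_i) -> f =1 g.
Proof.
move=> fgC fgX h; rewrite [h]mpolyE !rmorph_sum; apply: eq_bigr => m _ /=.
rewrite -mul_mpolyC !rmorphM fgC mpolyXE_id !rmorph_prod; congr (_ * _).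
by apply: eq_bigr => i _; rewrite !rmorphXn fgX.
Qed.

Lemma mcoeff_sqr n (F : fieldType) (f : {mpoly F[n]}) m : 2%N \in [pchar F] ->
  (f ^+ 2)@_(m + m) = f@_m ^+ 2.
Proof.
move=> char2; have mp2 : 2%N \in [pchar {mpoly F[n]}] := rmorph_pchar (@mpolyC n F) char2.
rewrite {1}[f]mpolyE sum_sqr // raddf_sum /=.
have E m' : ((f@_m' *: 'X_[m']) ^+ 2)@_(m + m) = f@_m' ^+ 2 * (m' == m)%:R.
  rewrite exprZn mcoeffZ mpolyXn mcoeffX; congr (_ * _%:R).
  congr nat_of_bool; apply/eqP/eqP => [/mnmP E|->].
    by apply/mnmP => i; have := E i; rewrite mulmnE mnmDE; lia.
  by apply/mnmP => i; rewrite mulmnE.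
rewrite (eq_bigr _ (fun m' _ => E m')).
have [mf|/memN_msupp_eq0 mf0] := boolP (m \in msupp f).
  rewrite (bigD1_seq m) ?msupp_uniq //= eqxx mulr1 big1 ?addr0 // => m' /negPf->.
  by rewrite mulr0.
rewrite mf0 big1 ?expr0n // => m' _; have [->|] := eqVneq m' m; last by rewrite mulr0.
by rewrite mf0 expr0n mul0r.
Qed.

Lemma anisotropic_mpoly n (F : fieldType) (q : seq F) (f : nat -> {mpoly F[n]}) :
  2%N \in [pchar F] -> anisotropic q -> \sum_(j < size q) q`_j *: f j ^+ 2 = 0 ->
  forall j, (j < size q)%N -> f j = 0.
Proof.
move=> char2 /anisotropicP q_an f0 j ltj; apply/mpolyP => m; rewrite mcoeff0.
apply: (q_an (fun j => (f j)@_m)) ltj.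
have := congr1 (mcoeff (m + m)%MM) f0; rewrite raddf_sum mcoeff0 /= => E.
by rewrite -[RHS]E; apply: eq_bigr => i _; rewrite mcoeffZ mcoeff_sqr.
Qed.

Lemma diag_sum_map (F K : fieldType) (iota : {rmorphism F -> K}) (a : seq F) c :
  diag_sum (map iota a) c = \sum_(j < size a) iota a`_j * c j ^+ 2.
Proof.
by rewrite /diag_sum size_map; apply: eq_bigr => j _; rewrite (nth_map 0).
Qed.

Section FunctionField.
Variables (F : fieldType) (char2 : 2%N \in [pchar F]) (p : seq F).
Hypotheses (p_an : anisotropic p) (p_dim : (2 <= size p)%N).
Variables (K : fieldType) (iota : {rmorphism F -> K}) (x : 'I_(size p) -> K).

Definition ev : {mpoly F[size p]} -> K := mmap iota x.
HB.instance Definition _ := GRing.RMorphism.copy ev (mmap iota x).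

Hypothesis ev0P : forall d f, f \is d.-homog ->
  (ev f = 0 <-> exists g : {mpoly F[size p]}, f = g * form_poly p).
Hypothesis evK : forall y : K, exists d (f g : {mpoly F[size p]}),
  [/\ f \is d.-homog, g \is d.-homog, ev g != 0 & y = ev f / ev g].

Implicit Types f g : {mpoly F[size p]}.

Let char2K : 2%N \in [pchar K]. Proof. exact: (rmorph_pchar iota char2). Qed.
Let char2P : 2%N \in [pchar {poly K}].
Proof. exact: (rmorph_pchar (@polyC K) char2K). Qed.

Lemma evZ c f : ev (c *: f) = iota c * ev f. Proof. exact: mmapZ. Qed.
Lemma evX i : ev 'X_i = x i. Proof. by rewrite /ev mmapX mmap1U. Qed.

(* [f (x + t e_i)], as a polynomial in [t = 'X]. *)
Definition shift i : {mpoly F[size p]} -> {poly K} :=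
  mmap (polyC \o iota) (fun k => (x k)%:P + (k == i)%:R *: 'X).
HB.instance Definition _ i := GRing.RMorphism.copy (shift i)
  (mmap (polyC \o iota) (fun k => (x k)%:P + (k == i)%:R *: 'X)).

Lemma shiftZ i c f : shift i (c *: f) = iota c *: shift i f.
Proof. by rewrite /shift mmapZ /= mul_polyC. Qed.

Lemma shiftX i k : shift i 'X_k = (x k)%:P + (k == i)%:R *: 'X.
Proof. by rewrite /shift mmapX mmap1U. Qed.

Lemma coef0_shift i f : (shift i f)`_0 = ev f.
Proof.
rewrite -horner_coef0; apply: (@mpoly_morph_eq _ _ _ (horner_eval 0 \o shift i) ev).
  by move=> c; rewrite /= /shift /ev !mmapC /= /horner_eval hornerC.
by move=> k; rewrite /= shiftX evX /horner_eval !hornerE ?mulr0 ?addr0.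
Qed.

Definition pd i f : K := (shift i f)`_1.

Lemma pdM i f g : pd i (f * g) = ev f * pd i g + pd i f * ev g.
Proof.
by rewrite /pd rmorphM coefM !big_ord_recl big_ord0 /= !coef0_shift addr0.
Qed.

Lemma pdX i k : pd i 'X_k = (k == i)%:R.
Proof. by rewrite /pd shiftX coefD coefC coefZ coefX /= mulr1 add0r. Qed.

Lemma pdZ i c f : pd i (c *: f) = iota c * pd i f.
Proof. by rewrite /pd shiftZ coefZ. Qed.

Lemma pd_sum i (I : Type) (s : seq I) (f : I -> {mpoly F[size p]}) :
  pd i (\sum_(j <- s) f j) = \sum_(j <- s) pd i (f j).
Proof. by rewrite /pd rmorph_sum coef_sum. Qed.

Lemma sqr_var_homog n (k : 'I_n) : ('X_k ^+ 2 : {mpoly F[n]}) \is 2.-homog.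
Proof. by rewrite mpolyXn dhomogX /= mdegMn mdeg1. Qed.

Lemma form_poly_homog : form_poly p \is 2.-homog.
Proof. by apply: rpred_sum => i _; apply/dhomogZ/sqr_var_homog. Qed.

Lemma ev_form_poly : \sum_(i < size p) iota p`_i * x i ^+ 2 = 0.
Proof.
have : ev (form_poly p) = 0 by apply/(ev0P form_poly_homog); exists 1; rewrite mul1r.
by rewrite rmorph_sum => {2}<-; apply: eq_bigr => i _; rewrite /= evZ rmorphXn /= evX.
Qed.

Lemma shift_form_poly i : shift i (form_poly p) = iota p`_i *: 'X^2.
Proof.
rewrite rmorph_sum /= (eq_bigr (fun k : 'I_(size p) => (iota p`_k * x k ^+ 2)%:P +
    iota p`_k *: ((k == i)%:R *: 'X^2))) => [|k _]; last first.
  rewrite shiftZ rmorphXn /= shiftX sqrrD mulr2n (addrr_pchar2 char2P) addr0.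
  rewrite scalerDr; congr (_ + _); first by rewrite -mul_polyC -polyC_exp -polyCM.
  by rewrite exprZn; case: eqP; rewrite ?expr1n ?expr0n.
rewrite big_split /= -rmorph_sum ev_form_poly rmorph0 add0r (bigD1 i) //= eqxx scale1r.
by rewrite big1 ?addr0 // => k /negPf->; rewrite scale0r scaler0.
Qed.

Section DiagonalForm.
Variables (q : seq F) (q_an : anisotropic q).
Local Notation n := (size q).

Definition diag_mpoly (f : nat -> {mpoly F[size p]}) := \sum_(j < n) q`_j *: f j ^+ 2.

Lemma ev_diag_mpoly (f : nat -> {mpoly F[size p]}) :
  ev (diag_mpoly f) = diag_sum (map iota q) (fun j => ev (f j)).
Proof.
rewrite diag_sum_map rmorph_sum; apply: eq_bigr => j _ /=.
by rewrite evZ rmorphXn.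
Qed.

Lemma diag_mpoly_homog d (f : nat -> {mpoly F[size p]}) : (forall j, f j \is d.-homog) ->
  diag_mpoly f \is (d * 2).-homog.
Proof. by move=> fd; apply: rpred_sum => j _; apply/dhomogZ/dhomogMn. Qed.

(* If [diag_mpoly f = g * form_poly p], then comparing the coefficients of
   ['X^2] after [shift i] expresses the left-hand side as [iota p`_i * ev g]. *)
Lemma diag_sum_pd d (f : nat -> {mpoly F[size p]}) :
  (forall j, f j \is d.-homog) -> ev (diag_mpoly f) = 0 ->
  exists w, forall i, diag_sum (map iota q) (fun j => pd i (f j)) = iota p`_i * w.
Proof.
move=> fd /(ev0P (diag_mpoly_homog fd))[g fg]; exists (ev g) => i.
have := congr1 (fun h => (shift i h)`_2) fg.
rewrite rmorphM /= shift_form_poly -scalerAr coefZ coefMXn /= coef0_shift => <-.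
rewrite diag_sum_map rmorph_sum coef_sum; apply: eq_bigr => j _ /=.
rewrite shiftZ coefZ rmorphXn /= expr2 coefM !big_ord_recl big_ord0 /= addr0.
rewrite /bump /= !addn0 /= [X in X + _]mulrC addrCA [X in _ + X](addrr_pchar2 char2K).
by rewrite addr0.
Qed.

Variable z : 'I_(size p).

Definition split_var : {mpoly F[size p]} -> {poly {mpoly F[size p]}} :=
  mmap (polyC \o @mpolyC _ _) (fun k => if k == z then 'X else ('X_k)%:P).
HB.instance Definition _ := GRing.RMorphism.copy split_var
  (mmap (polyC \o @mpolyC _ _) (fun k => if k == z then 'X else ('X_k)%:P)).

Definition var_free f := split_var f = f%:P.

Lemma split_varZ c f : split_var (c *: f) = c%:MP%:P * split_var f.
Proof. exact: mmapZ. Qed.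

Lemma split_varX k : split_var 'X_k = if k == z then 'X else ('X_k)%:P.
Proof. by rewrite /split_var mmapX mmap1U. Qed.

Lemma var_freeD f g : var_free f -> var_free g -> var_free (f + g).
Proof. by rewrite /var_free !rmorphD /= => -> ->. Qed.

Lemma var_freeM f g : var_free f -> var_free g -> var_free (f * g).
Proof. by rewrite /var_free !rmorphM /= => -> ->. Qed.

Lemma var_freeC c : var_free c%:MP.
Proof. by rewrite /var_free /split_var mmapC. Qed.

Lemma var_freeZ c f : var_free f -> var_free (c *: f).
Proof. by rewrite -mul_mpolyC; apply/var_freeM/var_freeC. Qed.

Lemma var_freeX k : k != z -> var_free 'X_k.
Proof. by rewrite /var_free split_varX => /negPf->. Qed.

Lemma var_free_sum (I : Type) (s : seq I) (P : pred I) (f : I -> {mpoly F[size p]}) :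
  (forall j, P j -> var_free (f j)) -> var_free (\sum_(j <- s | P j) f j).
Proof.
move=> fr; apply: big_ind => //; last exact: var_freeD.
by rewrite -(mpolyC0 (size p) F); apply: var_freeC.
Qed.

Lemma coef_neq0 (i : 'I_(size p)) : p`_i != 0.
Proof.
apply/eqP => pi0; have /anisotropicP/(_ (fun j => (j == i)%:R)) := p_an.
move=> /(_ _ i (ltn_ord i)); rewrite eqxx /diag_sum => E.
suff /E/eqP : \sum_(j < size p) p`_j * (j == i :> nat)%:R ^+ 2 = 0 :> F.
  by rewrite oner_eq0.
rewrite big1 // => j _; case: eqP => [->|_]; first by rewrite pi0 mul0r.
by rewrite expr0n mulr0.
Qed.

(* A multiple of [form_poly p] which does not involve ['X_z] is zero, for
   degree reasons. *)
Lemma var_free_eq0 d f : f \is d.-homog -> var_free f -> ev f = 0 -> f = 0.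
Proof.
move=> fd ff /(ev0P fd)[g fg]; apply/eqP; rewrite -polyC_eq0 -ff fg rmorphM /=.
have [->|g0] := eqVneq (split_var g) 0; first by rewrite mul0r.
have : (size (split_var f) <= 1)%N by rewrite ff size_polyC leq_b1.
rewrite fg rmorphM /=.
have -> : split_var (form_poly p) = (p`_z)%:MP *: 'X^2 +
    (\sum_(k | k != z) p`_k *: 'X_k ^+ 2)%:P.
  rewrite rmorph_sum (bigD1 z) //= split_varZ rmorphXn /= split_varX eqxx mul_polyC.
  congr (_ + _); rewrite rmorph_sum; apply: eq_bigr => k kz.
  by rewrite split_varZ rmorphXn /= split_varX (negPf kz) -rmorphXn -rmorphM /= mul_mpolyC.
have pz0 : (p`_z)%:MP_[size p] != 0 by rewrite mpolyC_eq0 coef_neq0.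
set c := polyC _; have sz : size ((p`_z)%:MP *: 'X^2 + c) = 3%N.
  rewrite size_polyDl size_scale ?size_polyXn //.
  by rewrite (leq_ltn_trans (size_polyC_leq1 _)).
by rewrite size_mul // -?size_poly_eq0 sz //; move: g0; rewrite -size_poly_eq0; lia.
Qed.

(* [f] is congruent to [a + 'X_z * b] modulo [form_poly p], with [a] and [b]
   free of ['X_z]; only the values at [x] and the derivatives along ['X_z]
   are recorded. *)
Definition reducible d f := exists a b,
  [/\ a \is d.-homog, b \is d.-1.-homog & d = 0%N -> b = 0] /\
  [/\ var_free a, var_free b, ev f = ev a + x z * ev b & pd z f = ev b].

Lemma reducible_lin d c f g : reducible d f -> reducible d g -> reducible d (c *: f + g).
Proof.
move=> [a [b [[ad bd b0] [af bf ef df]]]] [a' [b' [[ad' bd' b0'] [af' bf' ef' df']]]].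
exists (c *: a + a'), (c *: b + b'); split; split.
- by apply: dhomogD => //; apply: dhomogZ.
- by apply: dhomogD => //; apply: dhomogZ.
- by move=> d0; rewrite b0 // b0' // scaler0 addr0.
- by apply: var_freeD => //; apply: var_freeZ.
- by apply: var_freeD => //; apply: var_freeZ.
- by rewrite !rmorphD /= !evZ ef ef'; ring.
- by rewrite /pd rmorphD coefD /= -/(pd z _) pdZ df -/(pd z g) df' rmorphD /= evZ.
Qed.

Lemma sqr_var : exists c, [/\ c \is 2.-homog, var_free c & ev c = x z ^+ 2].
Proof.
exists ((p`_z)^-1 *: \sum_(k | k != z) p`_k *: 'X_k ^+ 2); split.
- apply: dhomogZ; apply: rpred_sum => k _; exact/dhomogZ/sqr_var_homog.
- apply/var_freeZ/var_free_sum => k kz; rewrite expr2.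
  by apply/var_freeZ/var_freeM; exact: var_freeX.
- have := ev_form_poly; rewrite (bigD1 z) //= => /eqP.
  rewrite addr_eq0 (oppr_pchar2 char2K) => /eqP E.
  rewrite evZ rmorph_sum /= (eq_bigr (fun k : 'I_(size p) => iota p`_k * x k ^+ 2)) => [|k _].
    by rewrite -E fmorphV mulKf // fmorph_eq0 coef_neq0.
  by rewrite evZ rmorphXn /= evX.
Qed.

Lemma reducibleX k d f : reducible d f -> reducible d.+1 ('X_k * f).
Proof.
move=> [a [b [[ad bd b0] [af bf ef df]]]].
have Xd i : ('X_i : {mpoly F[size p]}) \is 1.-homog by rewrite dhomogX /= mdeg1.
have [->|kz] := eqVneq k z; last first.
  exists ('X_k * a), ('X_k * b); split; split=> //.
  - by rewrite -add1n; apply: dhomogM.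
  - have [d0|d0] := posnP d; first by rewrite b0 // mulr0 dhomog0.
    by rewrite [d in d.-homog](_ : _ = 1 + d.-1)%N ?dhomogM //; lia.
  - exact/var_freeM/af/var_freeX.
  - exact/var_freeM/bf/var_freeX.
  - by rewrite !rmorphM /= ef; ring.
  - by rewrite pdM pdX (negPf kz) mul0r addr0 df rmorphM.
have [c [cd cf ec]] := sqr_var.
exists (c * b), a; split; split=> //.
- have [d0|d0] := posnP d; first by rewrite b0 // mulr0 dhomog0.
  by rewrite (_ : d.+1 = 2 + d.-1)%N ?dhomogM //; lia.
- exact: var_freeM.
- by rewrite !rmorphM /= ef evX ec; ring.
- rewrite pdM pdX eqxx mul1r df ef evX addrC -addrA.
  by rewrite (addrr_pchar2 char2K) addr0.
Qed.

Lemma reducible_homog d f : f \is d.-homog -> reducible d f.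
Proof.
have red0 : reducible d 0.
  exists 0, 0; split; split; rewrite ?dhomog0 //.
  - by rewrite /var_free !rmorph0.
  - by rewrite /var_free !rmorph0.
  - by rewrite rmorph0 mulr0 addr0.
  - by rewrite /pd rmorph0 coef0 rmorph0.
have redX m : reducible (mdeg m) 'X_[m].
  elim: (mdeg m) {-2}m (erefl (mdeg m)) => [|e IH] m' md.
    rewrite md; move/eqP: md; rewrite mdeg_eq0 => /eqP->; rewrite mpolyX0.
    exists 1, 0; split; split; rewrite ?dhomog0 ?dhomog1 //.
    - by rewrite -(mpolyC1 (size p) F); apply: var_freeC.
    - by rewrite /var_free !rmorph0.
    - by rewrite rmorph0 mulr0 addr0.
    - by rewrite /pd !rmorph1 rmorph0 coef1.
  have [k mk] : exists k, (0 < m' k)%N.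
    apply/existsP; apply: contraT; rewrite negb_exists => /forallP m0.
    by move: md; rewrite mdegE big1 // => i _; have := m0 i; lia.
  have mE : m' = (U_(k) + (m' - U_(k)))%MM.
    by rewrite addmC submK //; apply/mnm_lepP => i; rewrite mnm1E; case: eqP => // <-.
  have dm : mdeg (m' - U_(k)) = e by move: md; rewrite {1}mE mdegD mdeg1; lia.
  by rewrite md mE mpolyXD -{1}dm; apply/reducibleX/IH.
move=> fd; rewrite [f]mpolyE big_seq.
apply: (big_ind (reducible d)) => // [g h rg rh|m mf].
  by rewrite -[g]scale1r; apply: reducible_lin.
rewrite -[_ *: _]addr0; apply: reducible_lin => //.
by rewrite -(dhomog_mf fd mf); apply: redX.
Qed.

Lemma diag_sum_pd_inj d (f : nat -> {mpoly F[size p]}) : (forall j, f j \is d.-homog) ->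
  ev (diag_mpoly f) = 0 -> diag_sum (map iota q) (fun j => pd z (f j)) = 0 ->
  forall j, (j < n)%N -> ev (f j) = 0.
Proof.
move=> fd f0 df0.
have /choice[a /choice[b ab]] : forall j, exists a b,
  [/\ a \is d.-homog, b \is d.-1.-homog & d = 0%N -> b = 0] /\
  [/\ var_free a, var_free b, ev (f j) = ev a + x z * ev b & pd z (f j) = ev b].
  by move=> j; apply: reducible_homog.
have vanish e (c : nat -> {mpoly F[size p]}) : (forall j, c j \is e.-homog) ->
    (forall j, var_free (c j)) -> diag_sum (map iota q) (fun j => ev (c j)) = 0 ->
    forall j, (j < n)%N -> c j = 0.
  move=> ce cf c0; apply: anisotropic_mpoly => //; rewrite -/(diag_mpoly c).
  apply: (var_free_eq0 (diag_mpoly_homog ce)); last by rewrite ev_diag_mpoly.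
  by apply: var_free_sum => j _; apply: var_freeZ; rewrite expr2; exact: var_freeM.
have b0 : forall j, (j < n)%N -> b j = 0.
  apply: (vanish d.-1) => [j|j|]; try by have [[? ? ?] [? ? ? ?]] := ab j.
  rewrite -[RHS]df0 !diag_sum_map; apply: eq_bigr => j _.
  by have [_ [_ _ _ ->]] := ab j.
have efa j : (j < n)%N -> ev (f j) = ev (a j).
  by move=> /b0 bj; have [_ [_ _ -> _]] := ab j; rewrite bj rmorph0 mulr0 addr0.
move=> j ltj; rewrite efa // (vanish d a) ?rmorph0 //.
- by move=> i; have [[? ? ?] _] := ab i.
- by move=> i; have [_ [? ? ? ?]] := ab i.
rewrite -[RHS]f0 ev_diag_mpoly !diag_sum_map; apply: eq_bigr => i _.
by rewrite efa.
Qed.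

End DiagonalForm.

Lemma common_denominator (s : seq K) : exists d g (h : K -> {mpoly F[size p]}),
  [/\ g \is d.-homog, ev g != 0, forall t, h t \is d.-homog
    & forall t, t \in s -> t = ev (h t) / ev g].
Proof.
elim: s => [|t s [d [g [h [gd g0 hd hs]]]]].
  exists 0%N, 1, (fun=> 0); split=> //; first exact: dhomog1.
    by rewrite rmorph1 oner_eq0.
  by move=> t; apply: dhomog0.
have [e [f' [g' [fe ge g'0 tE]]]] := evK t.
exists (d + e)%N, (g * g'), (fun u => if u == t then g * f' else h u * g'); split.
- exact: dhomogM.
- by rewrite rmorphM mulf_neq0.
- by move=> u; case: eqP => _; apply: dhomogM => //; apply: hd.
move=> u; rewrite inE; have [-> _|_ /= /hs {1}->] := eqVneq u t.
  by rewrite !rmorphM /= -mulf_div divff // mul1r.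
by rewrite !rmorphM /= -mulf_div (divff g'0) mulr1.
Qed.

Lemma diag_sum_linear (a : seq K) (I : Type) (s : seq I) (c : I -> K) (f : I -> nat -> K) :
  diag_sum a (fun j => \sum_(r <- s) c r * f r j) =
  \sum_(r <- s) c r ^+ 2 * diag_sum a (f r).
Proof.
rewrite /diag_sum (eq_bigr (fun i : 'I_(size a) =>
  \sum_(r <- s) c r ^+ 2 * (a`_i * f r i ^+ 2))) => [|i _].
  by rewrite exchange_big; apply: eq_bigr => r _; rewrite mulr_sumr.
by rewrite sum_sqr // mulr_sumr; apply: eq_bigr => r _; rewrite exprMn mulrCA.
Qed.

Lemma diag_sumD (a : seq K) (c d : nat -> K) :
  diag_sum a (fun j => c j + d j) = diag_sum a c + diag_sum a d.
Proof.
rewrite -big_split; apply: eq_bigr => i _ /=.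
by rewrite sqrrD mulr2n (addrr_pchar2 char2K) addr0 mulrDr.
Qed.

Section Multipliers.
Variables (q : seq F) (q_an : anisotropic q).

Lemma isotropic_multipliers : exists w : seq K,
  [/\ anisotropic w, size w = i0 (map iota q)
    & forall i y, (i < size p)%N -> y \in w -> values (map iota q) (iota p`_i * y)].
Proof.
have [U UE] := isotropic_space char2K (map iota q).
pose z : 'I_(size p) := Ordinal (ltnW p_dim).
have pz0 : iota p`_z != 0 by rewrite fmorph_eq0 coef_neq0.
pose k := \dim U; pose n := size (map iota q).
pose u r (j : nat) : K := if insub j is Some i then (vbasis U)`_r 0 (i : 'I_n) else 0.
have [d [g [h [gd g0 hd hs]]]] :=
  common_denominator
    [seq (vbasis U)`_(r : 'I_k) 0 (i : 'I_n) | r <- enum 'I_k, i <- enum 'I_n].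
pose f r j := h (u r j).
have fE (r : 'I_k) (i : 'I_n) : ev (f r i) = u r i * ev g.
  rewrite /f; set t := u r i; rewrite {2}(hs t) ?divfK // /t /u valK.
  by apply: allpairs_f; rewrite mem_enum.
have f0 (r : 'I_k) : diag_sum (map iota q) (fun j => ev (f r j)) = 0.
  have : (vbasis U)`_r \in U by rewrite vbasis_mem // mem_nth // size_tuple.
  rewrite UE => /eqP E; rewrite -[RHS](mulr0 (ev g ^+ 2)) -E /qval mulr_sumr.
  by apply: eq_bigr => i _; rewrite fE /u valK exprMn [_ ^+ 2 * _]mulrC mulrCA.
have /choice[w wE] : forall r, exists w, (r < k)%N -> forall i,
    diag_sum (map iota q) (fun j => pd i (f r j)) = iota p`_i * w.
  move=> r; have [ltr|] := ltnP r k; last by exists 0.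
  have [|w wE] := @diag_sum_pd q d (f r) (fun j => hd _); last by exists w.
  by rewrite ev_diag_mpoly (f0 (Ordinal ltr)).
exists (mkseq w k); split.
- apply/anisotropicP => c; rewrite {1}/diag_sum size_mkseq => c0.
  have {}c0 : \sum_(r < k) w r * c r ^+ 2 = 0.
    by rewrite -[RHS]c0; apply: eq_bigr => r _; rewrite nth_mkseq.
  have [e [g' [l [gd' g0' ld ls]]]] := common_denominator [seq c (val r) | r <- enum 'I_k].
  have lE (r : 'I_k) : ev (l (c r)) = c r * ev g'.
    by rewrite {2}(ls (c r)) ?divfK // map_f // mem_enum.
  pose G j := \sum_(r < k) l (c r) * f r j.
  have Gd j : G j \is (e + d).-homog.
    by apply: rpred_sum => r _; apply: dhomogM; [apply: ld | apply: hd].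
  have evG j : ev (G j) = \sum_(r < k) ev (l (c r)) * ev (f r j).
    by rewrite rmorph_sum; apply: eq_bigr => r _; rewrite rmorphM.
  have G0 : ev (diag_mpoly q G) = 0.
    rewrite ev_diag_mpoly (eq_fun evG) diag_sum_linear big1 // => r _.
    by rewrite f0 mulr0.
  have pdG j : pd z (G j) = \sum_(r < k) ev (l (c r)) * pd z (f r j) +
      \sum_(r < k) pd z (l (c r)) * ev (f r j).
    by rewrite pd_sum -big_split; apply: eq_bigr => r _; rewrite pdM.
  have dG0 : diag_sum (map iota q) (fun j => pd z (G j)) = 0.
    rewrite (eq_fun pdG) diag_sumD !diag_sum_linear.
    rewrite [X in _ + X]big1 ?addr0 => [|r _]; last by rewrite f0 mulr0.
    transitivity (\sum_(r < k) iota p`_z * ev g' ^+ 2 * (w r * c r ^+ 2)).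
      by apply: eq_bigr => r _; rewrite wE // lE; ring.
    by rewrite -mulr_sumr c0 mulr0.
  have cu0 : \sum_(r < k) c r *: (vbasis U)`_r = 0.
    apply/rowP => i; rewrite mxE summxE.
    apply/(mulIf (mulf_neq0 g0' g0)); rewrite mul0r mulr_suml.
    have lti : (i < size q)%N by rewrite -(size_map iota q).
    rewrite -[RHS](diag_sum_pd_inj q_an Gd G0 dG0 lti) evG.
    by apply: eq_bigr => r _; rewrite mxE lE fE /u valK; ring.
  move=> r ltr.
  by have /freeP/(_ _ cu0 (Ordinal ltr)) := basis_free (vbasisP U).
- by rewrite size_mkseq (i0_isotropic_space UE).
move=> i y lti /(nthP 0)[r]; rewrite size_mkseq => ltr <-; rewrite nth_mkseq //.
by apply/valuesP; exists (fun j => pd (Ordinal lti) (f r j)); rewrite wE.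
Qed.

End Multipliers.
End FunctionField.

(** * Divisibility and the norm field *)

Section Isometry.
Variables (F : fieldType) (char2 : 2%N \in [pchar F]).
Implicit Types (a b c r pi : seq F) (x y z : F).

Lemma values_anpart a : values (anpart a) = values a.
Proof.
have [f [fS _ fq]] := anpartP char2 a.
apply/seteqP; split=> _ [v _ <-]; last by exists (f v).
by have [u <-] := fS v; rewrite fq; exists u.
Qed.

Lemma anisotropic_anpart a : anisotropic (anpart a).
Proof.
have [f [fS f0 fq]] := anpartP char2 a.
by move=> v v0; have [u uv] := fS v; rewrite -uv; apply/f0; rewrite -fq uv.
Qed.

Lemma isometric_values a b : isometric a b -> values a = values b.
Proof.
move=> [f [[g fK gK] fq]]; apply/seteqP; split=> _ [v _ <-].
  by exists (f v).
by exists (g v) => //; rewrite -fq gK.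
Qed.

Lemma isometric_anisotropic a b : isometric a b -> anisotropic a -> anisotropic b.
Proof.
move=> [f [[g fK gK] fq]] an v v0; rewrite -(gK v) in v0 *.
by rewrite (an (g v)) ?linear0 // -fq.
Qed.

Lemma anisotropic_tensorl a r : r != [::] -> anisotropic (tensor a r) -> anisotropic a.
Proof.
move=> r0 an; have [a' an' E] :=
  anisotropic_basis char2 (values_module char2 a) (@subset_refl _ _).
apply: (anisotropic_size char2 an'); first by rewrite E.
have := anisotropic_leq char2 an (values_tensorS (b := r) char2 _ (@subset_refl _ _)).
move=> /(_ a'); rewrite E => /(_ (@subset_refl _ _)); rewrite !size_tensor.
by rewrite leq_pmul2r // lt0n size_eq0.
Qed.

Lemma d0_stable a x : values a x -> x != 0 -> exists c,
  [/\ size c = d0 a, anisotropic (quasi_pfister c)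
    & forall y z, values (quasi_pfister c) y -> values a z -> values a (y * z)].
Proof.
move=> ax x0; pose P (s : 'I_(size a).+1) :=
  `[< exists2 pi, is_quasi_pfister s pi & divisible (anpart a) pi >].
rewrite /d0 -/(\max_(s | P s) nat_of_ord s).
have [P0|P0] := posnP #|P|; last first.
  have [s Ps ->] := @eq_bigmax_cond _ (mem P) (@nat_of_ord _) P0.
  move: Ps => /asboolP[pi [c [_ pic]] [r ar]]; exists c.
  have av := isometric_values ar; have piv := isometric_values pic.
  have an := isometric_anisotropic ar (@anisotropic_anpart a).
  rewrite values_anpart in av; split; first exact: size_tuple.
    apply: isometric_anisotropic pic (anisotropic_tensorl _ an).
    apply/eqP => r0; move: ax; rewrite av.
    have -> : tensor pi r = [::] by apply/nilP; rewrite /nilp size_tensor r0 muln0.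
    by move=> /valuesP[k]; rewrite /diag_sum big_ord0 => /eqP; rewrite (negPf x0).
  move=> y z cy; rewrite av; move: z.
  apply: (values_tensor_min (S := [set z | values (tensor pi r) (y * z)])).
    exact/sqr_moduleZ/values_module.
  move=> u v piu rv /=; rewrite mulrA; apply: values_tensor => //.
  by rewrite piv; apply: quasi_pfisterM => //; rewrite -piv.
exists [::]; split; [|exact: anisotropic1|].
  by rewrite big_pred0 // => s; apply: (card0_eq P0).
by move=> y z /values1[k ->]; have [_ _] := values_module char2 a; apply.
Qed.

Lemma has_degree_values a m : anisotropic a ->
  has_degree (@squares F) (values a) m <-> m = size a.
Proof.
move=> an; split=> [[e [eN eU]]|->].
  pose e' j := if insub j is Some i then e i else 0.
  have e'E (i : 'I_m) : e' i = e i by rewrite /e' valK.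
  have diagE k : diag_sum (mkseq e' m) k = \sum_(i < m) k i ^+ 2 * e i.
    rewrite /diag_sum size_mkseq; apply: eq_bigr => i _.
    by rewrite nth_mkseq // e'E mulrC.
  have vE : values (mkseq e' m) = values a.
    apply/seteqP; split=> z.
      apply: values_min; first exact: values_module.
      by move=> w /(nthP 0)[i]; rewrite size_mkseq => lti <-; rewrite nth_mkseq // /e' insubT.
    move=> /eU[c [[csq ->] _]]; apply/valuesP.
    have /choice[k kE] : forall j, exists k, (if insub j is Some i then c i else 0) = k ^+ 2.
      move=> j; case: insubP => [i _ _|_]; last by exists 0; rewrite expr0n.
      by have [k _ <-] := csq i; exists k.
    by exists k; rewrite diagE; apply: eq_bigr => i _; rewrite -kE valK.
  have an' : anisotropic (mkseq e' m).
    apply/anisotropicP => k; rewrite diagE size_mkseq => k0 i lti.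
    have a0 : values a 0 by case: (values_module char2 a).
    have [c [_ cU]] := eU _ a0.
    have c1 : c = [ffun i : 'I_m => k i ^+ 2].
      apply: cU; split=> [j|]; first by rewrite ffunE; exists (k j).
      by rewrite -[LHS]k0; apply: eq_bigr => j _; rewrite ffunE.
    have c2 : c = [ffun=> 0].
      apply: cU; split=> [j|]; first by rewrite ffunE; exists 0; rewrite ?expr0n.
      by rewrite big1 // => j _; rewrite ffunE mul0r.
    have /ffunP/(_ (Ordinal lti)) := c2; rewrite c1 !ffunE => /eqP.
    by rewrite sqrf_eq0 => /eqP.
  have : size (mkseq e' m) = size a.
    by apply/eqP; rewrite eqn_leq !anisotropic_leq // vE.
  by rewrite size_mkseq.
exists (fun i => a`_i); split=> [i|z /valuesP[k ->]].
  by apply/mem_values/mem_nth.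
exists [ffun i : 'I_(size a) => k i ^+ 2]; split.
  split=> [i|]; first by rewrite ffunE; exists (k i).
  by apply: eq_bigr => i _; rewrite ffunE mulrC.
move=> c [csq cE]; have /choice[l lE] : forall i, exists l, c i = l ^+ 2.
  by move=> i; have [l _ <-] := csq i; exists l.
pose l' j := if insub j is Some i then l i else 0.
apply/ffunP => i; rewrite ffunE lE.
have /anisotropicP/(_ (fun j => k j + l' j)) := an.
have -> : diag_sum a (fun j => k j + l' j) = diag_sum a k + \sum_i c i * a`_i.
  rewrite -big_split; apply: eq_bigr => j _ /=.
  by rewrite sqrrD mulr2n (addrr_pchar2 char2) addr0 mulrDr /l' valK lE [X in _ + X]mulrC.
rewrite -cE (addrr_pchar2 char2) => /(_ erefl i (ltn_ord i)) /eqP.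
by rewrite addr_eq0 (oppr_pchar2 char2) /l' valK => /eqP->.
Qed.

Lemma norm_field_values p x : values p x -> x != 0 ->
  norm_field p = values (quasi_pfister [seq y / x | y <- p]).
Proof.
move=> px x0; set Q := quasi_pfister _.
have QM := values_module char2 Q; have [Q0 QD QZ] := QM.
have [P0 PD PZ] := values_module char2 p.
apply/seteqP; split=> z.
  apply; split.
    split; first by rewrite inE; apply: quasi_pfister1.
      move=> u v; rewrite !inE => uQ vQ; apply: QD => //.
      by rewrite (oppr_pchar2 char2).
    move=> u v; rewrite !inE => uQ vQ; rewrite mulrC.
    apply: sqr_module_inv => //; exact: quasi_pfisterM.
  move=> _ [u [v [pu pv u0 v0 ->]]] /=.
  have ratio w : values p w -> values Q (w / x).
    move=> pw; rewrite mulrC; move: w pw.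
    apply: values_min; first exact: sqr_moduleZ.
    move=> w pw /=; rewrite mulrC; apply: mem_quasi_pfister => //; exact: map_f.
  have -> : u / v = (x / v) ^+ 2 * ((u / x) * (v / x)) by field; rewrite x0.
  by apply: QZ; apply: quasi_pfisterM => //; apply: ratio.
move=> Qz S [[S1 SB SV] pS]; rewrite inE in S1.
have S1' : S 1 by [].
have S0 : S 0 by have := SB 1 1; rewrite !inE subrr; apply.
have SD u v : S u -> S v -> S (u + v).
  by move=> Su Sv; have := SB u v; rewrite !inE (oppr_pchar2 char2); apply.
have SM u v : S u -> S v -> S (u * v).
  move=> Su Sv; have SVi : S v^-1 by have := SV 1 v; rewrite !inE mul1r; apply.
  by have := SV u v^-1; rewrite !inE invrK; apply.
have Sp u v : values p u -> values p v -> S (u / v).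
  move=> pu pv; have [->|u0] := eqVneq u 0; first by rewrite mul0r.
  have [->|v0] := eqVneq v 0; first by rewrite invr0 mulr0.
  by apply: pS; exists u, v.
have Sq u : S (u ^+ 2).
  have -> : u ^+ 2 = (u ^+ 2 * x) / x by field.
  by apply: Sp => //; apply: PZ.
apply: quasi_pfister_min Qz => //; first by split=> // u v; apply: SM.
move=> _ v /mapP[u up ->]; apply: SM; apply: Sp => //; exact: mem_values.
Qed.

Lemma lndeg_quasi_pfister p c : anisotropic (quasi_pfister c) ->
  norm_field p = values (quasi_pfister c) -> lndeg p = size c.
Proof.
move=> an E; rewrite /lndeg E.
case: xgetP => [m _ /(has_degree_values _ an)->|/(_ (size (quasi_pfister c)))].
  by rewrite size_quasi_pfister trunc_expnK.
by case; apply/has_degree_values.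
Qed.

End Isometry.

Section ScalarExtension.
Variables (F K : fieldType) (iota : {rmorphism F -> K}).

Lemma quasi_pfister_map c : map iota (quasi_pfister c) = quasi_pfister (map iota c).
Proof.
elim: c => [|x c /= <-] /=; first by rewrite rmorph1.
rewrite /tensor /= !cats0 map_cat -!map_comp; congr (_ ++ _).
  by apply: eq_map => y /=; rewrite !mul1r.
by apply: eq_map => y /=; rewrite rmorphM.
Qed.

End ScalarExtension.

Lemma function_field_multipliers (F : fieldType) (p q : seq F) (K : fieldType)
    (iota : {rmorphism F -> K}) : 2%N \in [pchar F] -> anisotropic p ->
  (2 <= size p)%N -> is_function_field p iota -> anisotropic q ->
  exists w : seq K, [/\ anisotropic w, size w = i0 (map iota q)
    & forall x y, x \in p -> y \in w -> values (map iota q) (iota x * y)].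
Proof.
move=> char2 p_an p_dim [x [x0 xK]] q_an.
have evE f : (map_mpoly iota f).@[x] = ev iota x f.
  apply: (@mpoly_morph_eq _ _ _ (meval x \o map_mpoly iota) (ev iota x)) => [c|i] /=.
    by rewrite map_mpolyC mevalC /ev mmapC.
  by rewrite map_mpolyX mevalXU evX.
have ev0 d (f : {mpoly F[size p]}) : f \is d.-homog ->
    (ev iota x f = 0 <-> exists g : {mpoly F[size p]}, f = g * form_poly p).
  by rewrite -evE; apply: x0.
have evK (y : K) : exists d (f g : {mpoly F[size p]}), [/\ f \is d.-homog, g \is d.-homog,
    ev iota x g != 0 & y = ev iota x f / ev iota x g].
  by have [d [f [g fg]]] := xK y; exists d, f, g; rewrite -!evE.
have [w [w_an wE wp]] := isotropic_multipliers char2 p_an p_dim ev0 evK q_an.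
by exists w; split=> // _ y /(nthP 0)[i lti <-]; apply: wp.
Qed.

Theorem theorem6p23 (F : fieldType) (char2 : 2%N \in [pchar F]) (p q : seq F)
    (p_an : anisotropic p) (q_an : anisotropic q)
    (p_dim : (2 <= size p)%N) (q_dim : (2 <= size q)%N)
    (K : fieldType) (iota : {rmorphism F -> K}) (KFp : is_function_field p iota)
    (eps : nat) (eps_range : (1 <= eps <= 2 ^ d1 iota p)%N)
    (eps_mod : (i0 (map iota q) + eps)%N = 0%N %[mod 2 ^ d1 iota p]) :
  (i0 (map iota q))%:R <= ((size q)%:R - eps%:R) / 2%:R :> rat
  \/ (2 ^ (lndeg p).-1 %| i0 (map iota q))%N.
Proof.
have char2K : 2%N \in [pchar K] := rmorph_pchar iota char2.
have multipliers := function_field_multipliers char2 p_an p_dim KFp.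
pose a0 := p`_0; have a0p : a0 \in p by apply: mem_nth; apply: ltnW.
have a0_neq0 : a0 != 0 by exact: (coef_neq0 p_an (Ordinal (ltnW p_dim))).
have ia0 : iota a0 != 0 by rewrite fmorph_eq0.
pose pK := map iota p; pose qK := map iota q.
have ia0p : iota a0 \in pK by apply: map_f.
have basis (a : seq K) : exists2 b, anisotropic b & values b = values a.
  exact: (anisotropic_basis char2K (values_module char2K a) (@subset_refl _ _)).
have [b b_an bE] := basis qK.
have i0b : (i0 qK + size b = size q)%N.
  by rewrite (i0_anisotropic_basis char2K b_an) ?bE // size_map.
pose U : set K := [set w | forall x, x \in p -> values qK (iota x * w)]%classic.
have VM := values_module char2K qK.
have UM : sqr_module U.
  have [V0 VD VZ] := VM; split=> [x _|u v uU vU x xp|c u uU x xp].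
  - by rewrite mulr0.
  - by rewrite mulrDr; apply: VD; [apply: uU | apply: vU].
  - by rewrite mulrCA; apply/VZ/uU.
have [u u_an uE] : exists2 u, anisotropic u & values u = U.
  apply: (@anisotropic_basis _ char2K U (map ( *%R (iota a0)^-1) qK) UM) => w wU.
  by apply/(values_scale char2K); exists (iota a0 * w); [apply: wU | rewrite mulKf].
have le_i0_u : (i0 qK <= size u)%N.
  have [w [w_an <- wU]] := multipliers q q_an.
  apply: (anisotropic_leq char2K w_an); rewrite uE.
  by apply: (values_min UM) => y yw x xp; apply: wU.
pose T := tensor pK u; have TM := values_module char2K T.
have [t t_an tE] := basis T.
have le_t_b : (size t <= size b)%N.
  apply: (anisotropic_leq char2K t_an); rewrite tE bE; apply: (values_min VM).
  move=> _ /mem_tensor[_ [y [/mapP[x xp ->] yu ->]]].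
  by have := mem_values yu; rewrite uE; apply.
have a0u_an : anisotropic (map ( *%R (iota a0)) u) by apply: anisotropic_scale.
have a0uT : (values (map ( *%R (iota a0)) u) `<=` values t)%classic.
  move=> _ /(values_scale char2K)[y yu ->]; rewrite tE.
  by apply: values_tensor => //; apply: mem_values.
have le_u_t : (size u <= size t)%N.
  by have := anisotropic_leq char2K a0u_an a0uT; rewrite size_map.
have dvd_t : (2 ^ d1 iota p %| size t)%N.
  have pK0 : values (anpart pK) (iota a0) by rewrite values_anpart //; apply: mem_values.
  have [c [dc c_an cp]] := d0_stable char2K pK0 ia0.
  rewrite /d1 -/pK -dc -size_quasi_pfister.
  apply: (dvdn_basis_over char2K c_an _ _ TM (b := T)) tE => //.
  - exact: quasi_pfister1.
  - exact: quasi_pfisterM.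
  move=> x y cx; move: y; apply: (values_tensor_min (S := [set y | values T (x * y)])).
    exact: sqr_moduleZ.
  move=> v v' pv uv' /=; rewrite mulrA; apply: values_tensor => //.
  by move: pv; rewrite -(values_anpart char2K pK); apply: cp.
have [lt_i0_t|le_t_i0] := ltnP (i0 qK) (size t).
  left; have le_eps : (i0 qK + eps <= size t)%N.
    have /dvdnP[k kE] : (2 ^ d1 iota p %| i0 qK + eps)%N by rewrite /dvdn eps_mod mod0n.
    have /dvdnP[l lE] := dvd_t; rewrite kE lE; move: eps_range => /andP[_ eps_le].
    rewrite leq_mul2r; apply/orP; right; rewrite leqNgt; apply/negP => lt_lk.
    have := leq_mul lt_lk (leqnn (2 ^ d1 iota p)); rewrite -kE mulSn -lE; lia.
  have : (2 * i0 qK + eps <= size q)%N by lia.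
  rewrite -(ler_nat rat) natrD natrM -/qK; lra.
right; have i0t : i0 qK = size t by lia.
have Ta0u : (values T `<=` values (map ( *%R (iota a0)) u))%classic.
  rewrite -tE; apply: (anisotropic_eq_values char2K a0u_an a0uT).
  by rewrite size_map (leq_trans le_t_i0).
pose Q0 := [seq y / a0 | y <- p].
have NE := norm_field_values char2 (mem_values a0p) a0_neq0.
have [c [c_an cE]] := quasi_pfister_anisotropic char2 Q0; rewrite -NE in cE.
have lE := lndeg_quasi_pfister char2 c_an (esym cE).
have [c' [c'_an c'E]] := quasi_pfister_anisotropic char2K (map iota c).
have stable x y : values (quasi_pfister c') x -> values T y -> values T (x * y).
  rewrite c'E => cx Ty.
  have stab0 z v : z \in Q0 -> values T v -> values T (iota z * v).
    move=> /mapP[z' z'p ->] /Ta0u /(values_scale char2K)[v' uv' ->].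
    rewrite fmorph_div mulrA divfK //.
    by apply: values_tensor => //; apply/mem_values/map_f.
  move: x cx; rewrite -quasi_pfister_map.
  apply: (values_min (S := [set x | values T (x * y)])).
    have := sqr_moduleZ y TM; rewrite /=.
    by under [X in sqr_module X]eq_set => x do rewrite mulrC.
  move=> _ /mapP[z /mem_values + ->] /=; rewrite cE NE.
  move=> Qz; move: z Qz y Ty.
  have : sqr_module [set z | forall y, values T y -> values T (iota z * y)].
    have [T0 TD TZ] := TM; split=> [v|z z' Sz Sz' v Tv|e z Sz v Tv] /=.
    - by rewrite rmorph0 mul0r.
    - by rewrite rmorphD mulrDl; apply: TD; [apply: Sz | apply: Sz'].
    - by rewrite rmorphM rmorphXn -mulrA; apply/TZ/Sz.
  move=> SM z Qz; apply: (quasi_pfister_min char2 SM _ _ Qz) => [v|n z' nQ Sz' v Tv] /=.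
    by rewrite rmorph1 mul1r.
  by rewrite rmorphM -mulrA; apply: stab0 => //; apply: Sz'.
have dvd_c' : (2 ^ size c' %| size t)%N.
  rewrite -size_quasi_pfister.
  apply: (dvdn_basis_over char2K c'_an _ _ TM (b := T)) tE => //.
  - exact: quasi_pfister1.
  - exact: quasi_pfisterM.
have le_c : (2 ^ size c <= 2 ^ (size c').+1)%N.
  have := i0_anisotropic_basis char2K c'_an; rewrite c'E -quasi_pfister_map.
  move=> /(_ _ erefl); rewrite size_map !size_quasi_pfister.
  have [w [w_an <- wU]] := multipliers _ c_an.
  have : (size w <= size (quasi_pfister c'))%N.
    rewrite -(size_map ( *%R (iota a0))).
    apply: (anisotropic_leq char2K (anisotropic_scale ia0 w_an)).
    apply: values_min; first exact: values_module.
    by move=> _ /mapP[y yw ->]; rewrite c'E -quasi_pfister_map; apply: wU.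
  by rewrite size_quasi_pfister expnS; lia.
rewrite i0t lE; apply: dvdn_trans dvd_c'; apply: dvdn_exp2l.
by move: le_c; rewrite leq_exp2l //; lia.
Qed.
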